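(* The problem of counting Eulerian tours in 4-regular graphs is polynomial-time Turing reducible to the problem of counting A-trails in 4-regular maps. That is, there is a polynomial-time algorithm with access to an oracle that returns the number of A-trails of any given 4-regular map, which on input an arbitrary 4-regular graph $G$ outputs the number of Eulerian tours of $G$.
   Context: Graphs are finite and undirected; parallel edges and loops are allowed. A graph is 4-regular if every vertex has degree 4 (a loop contributes 2). An Eulerian tour is a closed trail that travels each edge exactly once; tours are counted up to the choice of starting point and direction, i.e. an Eulerian tour is identified with the choice, at every vertex, of a perfect matching (''pairing'') of the edge-ends at that vertex such that following these pairings gives a single closed trail through all edges. A cyclic ordering $O^+(v)$ at a vertex $v$ of degree $d>0$ is an ordering $(e_1,\dots,e_d)$ of the edge-ends at $v$; $e_i$ and $e_{i+1}$ are called cyclicly-adjacent for $1\le i\le d$, where $e_{d+1}:=e_1$. A rotational embedding scheme of a graph is a choice of a cyclic ordering at each vertex; a map is a graph together with a rotational embedding scheme (no planarity is assumed). A 4-regular map is a map whose graph is 4-regular. An A-trail of a map is an Eulerian tour in which any two consecutive edges (including the last and the first), passing through a vertex $v$, are cyclicly-adjacent in $O^+(v)$; equivalently, at every vertex the pairing only pairs cyclicly-adjacent edge-ends. *)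

(* Defs.v *)
From HB Require Import structures.
From mathcomp Require Import all_boot all_order all_algebra.

Set Implicit Arguments.
Unset Strict Implicit.
Unset Printing Implicit Defensive.

(** * Multigraphs, Eulerian tours, maps and A-trails *)

(** Loops and parallel edges are allowed.  The edge [e] has the two edge-ends
    [(e, false)] and [(e, true)]. *)
Record multigraph := Multigraph {
  nv : nat;
  ne : nat;
  ends : {ffun 'I_ne * bool -> 'I_nv} }.

Definition edge_end (G : multigraph) : finType := ('I_(ne G) * bool)%type.

Definition endv (G : multigraph) (x : edge_end G) : 'I_(nv G) := ends G x.

Definition opp_end (G : multigraph) (x : edge_end G) : edge_end G :=
  (x.1, ~~ x.2).

Definition ends_at (G : multigraph) (v : 'I_(nv G)) : {set edge_end G} :=
  [set x | endv x == v].

Definition four_regular (G : multigraph) : bool :=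
  [forall v : 'I_(nv G), #|ends_at v| == 4].

(** A perfect matching of the edge-ends at every vertex: [p x] is the partner
    of [x]. *)
Definition pairing (G : multigraph) (p : {ffun edge_end G -> edge_end G}) : bool :=
  [forall x, [&& p x != x, p (p x) == x & endv (p x) == endv x]].

(** Leave a vertex through the edge-end [x], traverse the edge, and leave the
    vertex reached through the partner of the edge-end of arrival. *)
Definition trail_step (G : multigraph) (p : {ffun edge_end G -> edge_end G})
    (x : edge_end G) : edge_end G := p (opp_end x).

(** The closed trail started at any edge-end [x] traverses, in one of the two
    directions, the edge carrying any edge-end [y].  (For a pairing it then
    does so exactly once.)  The empty graph has one tour, the empty one. *)
Definition single_trail (G : multigraph) (p : {ffun edge_end G -> edge_end G}) : bool :=
  [forall x, forall y, fconnect (trail_step p) x y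
                    || fconnect (trail_step p) x (opp_end y)].

Definition eulerian_tour (G : multigraph) (p : {ffun edge_end G -> edge_end G}) : bool :=
  pairing p && single_trail p.

Definition num_eulerian_tours (G : multigraph) : nat :=
  #|[set p : {ffun edge_end G -> edge_end G} | eulerian_tour p]|.

(** [rotation v] lists every edge-end at [v] exactly once. *)
Record rmap := RMap {
  rgraph :> multigraph;
  rotation : {ffun 'I_(nv rgraph) -> seq (edge_end rgraph)};
  rotationP : [forall v, perm_eq (rotation v) (enum (ends_at v))] }.

Definition cyclicly_adjacent (T : eqType) (s : seq T) (x y : T) : bool :=
  [&& x \in s, y \in s & (next s x == y) || (next s y == x)].

Definition A_trail (M : rmap) (p : {ffun edge_end M -> edge_end M}) : bool :=
  eulerian_tour p && [forall x, cyclicly_adjacent (rotation M (endv x)) x (p x)].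

Definition num_A_trails (M : rmap) : nat :=
  #|[set p : {ffun edge_end M -> edge_end M} | @A_trail M p]|.

(** * Oracle programs with logarithmic cost *)

(** Random-access programs over natural numbers stored in arrays, structured
    by sequencing, conditionals and loops.  Arrays have static names and are
    indexed dynamically; subtraction is truncated and division by 0 gives 0. *)
Inductive expr :=
  | Cst of nat
  | Get of nat & expr
  | Add of expr & expr
  | Sub of expr & expr
  | Mul of expr & expr
  | Div of expr & expr.

(** [Put a i e] is [a[i] := e].  [Ask a l b] submits the first [l] cells of
    [a] to the oracle and writes the answer to [b[0]].  A test succeeds when
    its value is nonzero. *)
Inductive prog :=
  | Skip
  | Put of nat & expr & expr
  | Seq of prog & prog
  | If of expr & prog & prog
  | While of expr & prog
  | Ask of nat & expr & nat.

Definition store := nat -> nat -> nat.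

Definition upd (s : store) (a i n : nat) : store :=
  fun b j => if (b == a) && (j == i) then n else s b j.

Definition bits (n : nat) : nat := (trunc_log 2 n).+1.

Definition word_size (w : seq nat) : nat := \sum_(n <- w) bits n.

Fixpoint eval (s : store) (e : expr) : nat :=
  match e with
  | Cst n => n
  | Get a e1 => s a (eval s e1)
  | Add e1 e2 => eval s e1 + eval s e2
  | Sub e1 e2 => eval s e1 - eval s e2
  | Mul e1 e2 => eval s e1 * eval s e2
  | Div e1 e2 => eval s e1 %/ eval s e2
  end.

(** Every subexpression is charged the binary length of its value, so that an
    operation pays for its operands and its result, and an array access for
    the address and the contents. *)
Fixpoint ecost (s : store) (e : expr) : nat :=
  bits (eval s e) +
  match e with
  | Cst _ => 0
  | Get _ e1 => ecost s e1
  | Add e1 e2 | Sub e1 e2 | Mul e1 e2 | Div e1 e2 => ecost s e1 + ecost s e2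
  end.

Definition query (s : store) (a l : nat) : seq nat := mkseq (s a) l.

(** [exec f c s s' t]: with oracle [f], the program [c] started in [s] halts
    in [s'] after time [t]. *)
Inductive exec (f : seq nat -> nat) : prog -> store -> store -> nat -> Prop :=
  | ExecSkip s : exec f Skip s s 1
  | ExecPut a i e s :
      exec f (Put a i e) s (upd s a (eval s i) (eval s e)) (ecost s i + ecost s e)
  | ExecSeq c1 c2 s1 s2 s3 t1 t2 :
      exec f c1 s1 s2 t1 -> exec f c2 s2 s3 t2 ->
      exec f (Seq c1 c2) s1 s3 (t1 + t2)
  | ExecIfTrue e c1 c2 s s' t :
      eval s e != 0 -> exec f c1 s s' t -> exec f (If e c1 c2) s s' (ecost s e + t)
  | ExecIfFalse e c1 c2 s s' t :
      eval s e = 0 -> exec f c2 s s' t -> exec f (If e c1 c2) s s' (ecost s e + t)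
  | ExecWhileTrue e c s1 s2 s3 t1 t2 :
      eval s1 e != 0 -> exec f c s1 s2 t1 -> exec f (While e c) s2 s3 t2 ->
      exec f (While e c) s1 s3 (ecost s1 e + t1 + t2)
  | ExecWhileFalse e c s :
      eval s e = 0 -> exec f (While e c) s s (ecost s e)
  | ExecAsk a l b s :
      let w := query s a (eval s l) in
      exec f (Ask a l b) s (upd s b 0 (f w)) (ecost s l + word_size w + bits (f w)).

(** The input word is array 0 and its length is in cell 0 of array 1; all
    other cells are 0.  The result is read from cell 0 of array 1. *)
Definition init_store (w : seq nat) : store :=
  fun a i => if a == 0 then nth 0 w i
             else if (a == 1) && (i == 0) then size w else 0.

Definition output (s : store) : nat := s 1 0.

(** * Polynomial-time Turing reductions between counting problems *)

Record counting_problem := CountingProblem {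
  instance : Type;
  encoding : instance -> seq nat;
  answer : instance -> nat }.

(** Nothing is assumed about answers to words that encode no instance. *)
Definition oracle_for (B : counting_problem) (f : seq nat -> nat) : Prop :=
  forall y : instance B, f (encoding y) = answer y.

Definition poly_time_Turing_reducible (A B : counting_problem) : Prop :=
  exists (c : prog) (P : {poly nat}),
    forall f : seq nat -> nat, oracle_for B f ->
    forall x : instance A, exists (s : store) (t : nat),
      [/\ exec f c (init_store (encoding x)) s t,
          t <= P.[word_size (encoding x)]%R
        & output s = answer x].

(** A graph is coded by its numbers of vertices and edges followed by the two
    endpoints of each edge; a map moreover lists the edge-ends [2 e + b] in
    cyclic order around each vertex in turn. *)
Definition code_graph (G : multigraph) : seq nat :=
  [:: nv G, ne G
    & flatten [seq [:: val (ends G (e, false)); val (ends G (e, true))]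
              | e <- enum 'I_(ne G)]].

Definition code_end (G : multigraph) (x : edge_end G) : nat := x.1.*2 + x.2.

Definition code_map (M : rmap) : seq nat :=
  code_graph M ++
  flatten [seq [seq code_end x | x <- rotation M v] | v <- enum 'I_(nv M)].

Lemma flatten_map_inj (I : eqType) (T : eqType) (s : seq I) (F H : I -> seq T) :
  (forall i, size (F i) = size (H i)) ->
  flatten [seq F i | i <- s] = flatten [seq H i | i <- s] ->
  {in s, forall i, F i = H i}.
Proof.
move=> sz; elim: s => //= a s IH /eqP; rewrite eqseq_cat // => /andP[/eqP e /eqP /IH h] i.
by rewrite inE => /predU1P[->|/h].
Qed.

Lemma code_end_inj G : injective (@code_end G).
Proof.
move=> [x b] [y c]; rewrite /code_end /= => h.
have hb : b = c.
  by move: (congr1 odd h); rewrite ![_.*2 + _]addnC !oddD !odd_double !addbF; case: b c {h} => [] [].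
by subst c; congr pair; apply/val_inj; move/eqP: h; rewrite eqn_add2r => /eqP /double_inj.
Qed.

Lemma size_rotation (M : rmap) v : size (rotation M v) = #|ends_at v|.
Proof. by rewrite cardE; apply/perm_size; move/forallP: (rotationP M). Qed.

(** Hence an oracle for counting A-trails exists: the answers required of it
    are consistent. *)
Lemma code_map_inj : injective code_map.
Proof.
move=> [[n m e] r p] [[n' m' e'] r' p']; rewrite /code_map /code_graph /= => -[? ?]; subst n' m'.
move/eqP; rewrite eqseq_cat; last first.
  by rewrite !size_flatten /shape -!map_comp.
case/andP => /eqP /flatten_map_inj h1 /eqP.
have ee : e = e'.
  apply/ffunP => -[i b]; have hi : i \in enum 'I_m by rewrite mem_enum.
  have [h2 h3] := h1 (fun _ => erefl) i hi.
  by case: b; apply: val_inj.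
subst e' => /flatten_map_inj h.
have er : r = r'.
  apply/ffunP => v; apply: (inj_map (@code_end_inj _)); apply: h; last by rewrite mem_enum.
  by move=> w; rewrite !size_map (@size_rotation (RMap p)) (@size_rotation (RMap p')).
by subst r'; congr RMap; exact: eq_irrelevance.
Qed.

Definition ET_4regular : counting_problem :=
  @CountingProblem {G : multigraph | four_regular G}
    (fun G => code_graph (sval G)) (fun G => num_eulerian_tours (sval G)).

Definition A_trails_4regular : counting_problem :=
  @CountingProblem {M : rmap | four_regular M}
    (fun M => code_map (sval M)) (fun M => num_A_trails (sval M)).

(* Main.v *)
From mathcomp Require Import all_boot all_order all_algebra.
From mathcomp Require Import zify.
Require Import Defs.

Set Implicit Arguments.
Unset Strict Implicit.
Unset Printing Implicit Defensive.

(** One oracle call suffices.  Replace every vertex, with ends [a, b, c, d], by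
    a triangle on three vertices with rotations [(a, q, e2, e1)],
    [(b, s, f2, f1)] and [(q', c, s', d)], where [e1]-[f1], [e2]-[f2], [q]-[q']
    and [s]-[s'] are the new edges.  At each of the three vertices there are two
    pairings of cyclicly adjacent ends.  Of the eight combinations, two leave a
    closed trail inside the triangle, and each of the three pairings of
    [a, b, c, d] is induced by exactly two of the other six.  So a graph with [n]
    vertices and [N] Eulerian tours yields a map with [2 ^ n * N] A-trails; the
    program writes the code of this map, queries it and halves the answer [n]
    times.

    Whether a pairing gives a single closed trail is tested by colourings of the
    edge-ends: it does if and only if every 2-colouring that agrees on the two
    ends of each edge and on paired ends is constant.  Such colourings are easy
    to restrict to the outer ends of the triangles and to extend back. *)

(** * Tours and colourings of edge-ends *)

Definition joined (D : finType) (o p : D -> D) : bool :=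
  [forall f : {ffun D -> bool},
     [forall x, (f (o x) == f x) && (f (p x) == f x)] ==>
     [forall x, forall y, f x == f y]].

Lemma joinedP (D : finType) (o p : D -> D) :
  reflect (forall f : D -> bool, (forall x, f (o x) = f x) ->
             (forall x, f (p x) = f x) -> forall x y, f x = f y)
          (joined o p).
Proof.
apply: (iffP forallP) => [J f fo fp x y | J f].
  have I : [forall x, (finfun f (o x) == finfun f x) && (finfun f (p x) == finfun f x)].
    by apply/forallP => z; rewrite !ffunE fo fp !eqxx.
  by have /implyP/(_ I)/forallP/(_ x)/forallP/(_ y) := J (finfun f); rewrite !ffunE => /eqP.
apply/implyP => /forallP I; apply/forallP => x; apply/forallP => y; apply/eqP.
by apply: J => z; case/andP: (I z) => /eqP ? /eqP.
Qed.

Lemma joined_conj (C D : finType) (u : C -> D) (u' : D -> C) (o p : C -> C) (o' p' : D -> D) :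
  cancel u u' -> cancel u' u ->
  (forall x, o' (u x) = u (o x)) -> (forall x, p' (u x) = u (p x)) ->
  joined o p = joined o' p'.
Proof.
move=> uK u'K ho hp; apply/joinedP/joinedP => J f fo fp x y.
  rewrite -(u'K x) -(u'K y); apply: (J (f \o u)) => z /=; by rewrite -?ho -?hp.
rewrite -(uK x) -(uK y); apply: (J (f \o u')) => z /=.
  by rewrite -(u'K z) ho !uK fo.
by rewrite -(u'K z) hp !uK fp.
Qed.

Lemma opp_endK G : involutive (@opp_end G).
Proof. by case=> e b; rewrite /opp_end /= negbK. Qed.

Lemma single_trailE (G : multigraph) (p : {ffun edge_end G -> edge_end G}) :
  pairing p -> single_trail p = joined (@opp_end G) p.
Proof.
move=> /forallP hp.
have pK : involutive p by move=> x; case/and3P: (hp x) => _ /eqP.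
have step_inj : injective (trail_step p).
  by move=> x y /(can_inj pK) /(can_inj (@opp_endK G)).
have stepC := fconnect_sym step_inj.
apply/idP/joinedP => [/forallP T f fo fp x y | J].
  have fc z t : fconnect (trail_step p) z t -> f z = f t.
    move/iter_findex => <-; elim: (findex _ z t) => [//|k IH] /=.
    by rewrite IH /trail_step fp fo.
  by have /forallP/(_ y)/orP[/fc|/fc] := T x; rewrite ?fo.
apply/forallP => x; apply/forallP => y.
(* The ends of the edges that the trail from [x] traverses in either direction. Since [trail_step]
   sends [opp_end z] to [p z] and [opp_end (p z)] to [z], this set is closed under [p]. *)
pose f z := fconnect (trail_step p) x z || fconnect (trail_step p) x (opp_end z).
rewrite -[_ || _]/(f y); suff -> : f y = f x by rewrite /f connect0.
apply: J => z; rewrite /f; first by rewrite opp_endK orbC.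
have hz : fconnect (trail_step p) (opp_end z) (p z).
  by apply: connect1; rewrite /= /trail_step opp_endK.
have hpz : fconnect (trail_step p) (opp_end (p z)) z.
  by apply: connect1; rewrite /= /trail_step opp_endK pK.
rewrite orbC; congr (_ || _); apply/idP/idP => h.
- exact: connect_trans h hpz.
- by apply: connect_trans h _; rewrite stepC.
- by apply: connect_trans h _; rewrite stepC.
- exact: connect_trans h hz.
Qed.

(** Cyclic positions around a vertex are coded by bits in Gray order, so that
    the pairings at a vertex are the nonzero translations of [bool * bool] and
    those of cyclicly adjacent ends flip a single bit. *)
Definition shift (c : option bool) (j : bool * bool) : bool * bool :=
  match c with
  | Some false => (j.1, ~~ j.2)
  | Some true => (~~ j.1, j.2)
  | None => (~~ j.1, ~~ j.2)
  end.

Definition gray : seq (bool * bool) :=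
  [:: (false, false); (false, true); (true, true); (true, false)].

Definition translation (V : finType) (t : V -> option bool) (x : V * (bool * bool)) :=
  (x.1, shift (t x.1) x.2).

Lemma shiftK c : involutive (shift c).
Proof. by case: c => [[]|] [[] []]. Qed.

Lemma shift_neq c j : shift c j != j.
Proof. by case: c => [[]|]; case: j => [[] []]. Qed.

Lemma involution_shift (r : bool * bool -> bool * bool) :
  (forall j, r j != j) -> involutive r ->
  exists c, forall j, r j = shift c j.
Proof.
move=> rN rK.
have := rN (false, false); have := rN (false, true);
  have := rN (true, false); have := rN (true, true).
have := rK (false, false); have := rK (false, true);
  have := rK (true, false); have := rK (true, true).
(* Of the 256 tables of values, only the three perfect matchings of four points survive. *)
case e0: (r (false, false)) => [[] []]; case e1: (r (false, true)) => [[] []];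
  case e2: (r (true, false)) => [[] []]; case e3: (r (true, true)) => [[] []];
  rewrite ?(e0, e1, e2, e3) //= => _ _ _ _ _ _ _ _.
- by exists None => -[[] []].
- by exists (Some true) => -[[] []].
- by exists (Some false) => -[[] []].
Qed.

Lemma cyclicly_adjacent_gray c j : cyclicly_adjacent gray j (shift c j) = (c != None).
Proof. by case: c => [[]|]; case: j => [[] []]. Qed.

Lemma cyclicly_adjacent_map (T T' : eqType) (g : T -> T') s x y :
  injective g -> uniq s -> 
  cyclicly_adjacent (map g s) (g x) (g y) = cyclicly_adjacent s x y.
Proof.
move=> gI us; rewrite /cyclicly_adjacent !mem_map //.
by rewrite !(next_map gI) // !(inj_eq gI).
Qed.

(** * Pairings as families of nonzero translations, one for each vertex *)

Section Count.
Variables (G : multigraph) (V : finType).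
Variables (u : edge_end G -> V * (bool * bool)) (u' : V * (bool * bool) -> edge_end G).
Hypotheses (uK : cancel u u') (u'K : cancel u' u).
Hypothesis u_endv : forall x y, ((u x).1 == (u y).1) = (endv x == endv y).

Definition pairing_of (t : {ffun V -> option bool}) : {ffun edge_end G -> edge_end G} :=
  [ffun x => u' (translation t (u x))].

Lemma pairing_of_inj : injective pairing_of.
Proof.
move=> s t /ffunP h; apply/ffunP => v.
have := h (u' (v, (false, false))); rewrite !ffunE u'K => /(can_inj u'K) [].
by case: (s v) => [[]|]; case: (t v) => [[]|].
Qed.

Lemma pairing_pairing_of t : pairing (pairing_of t).
Proof.
apply/forallP => x; rewrite !ffunE u'K -(u_endv _ x) u'K /translation /= shiftK eqxx andbT.
rewrite -surjective_pairing uK eqxx andbT.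
by apply/eqP => /(congr1 u); rewrite u'K => /(congr1 snd) /= /eqP; apply/negP/shift_neq.
Qed.

Lemma pairingP p : pairing p -> exists t, p = pairing_of t.
Proof.
move=> /forallP hp.
pose r v j := (u (p (u' (v, j)))).2.
have hr v j : p (u' (v, j)) = u' (v, r v j).
  apply: (can_inj uK); rewrite u'K [LHS]surjective_pairing; congr pair.
  by case/and3P: (hp (u' (v, j))) => _ _; rewrite -u_endv u'K => /eqP.
have ex v : exists c, forall j, r v j == shift c j.
  case: (@involution_shift (r v)) => [j|j|c hc].
  - case/and3P: (hp (u' (v, j))) => h _ _; apply: contraNN h => /eqP h.
    by rewrite hr h.
  - case/and3P: (hp (u' (v, j))) => _ /eqP + _.
    by rewrite !hr => /(can_inj u'K) [].
  by exists c => j; apply/eqP.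
have ex' v : exists c, [forall j, r v j == shift c j].
  by case: (ex v) => c hc; exists c; apply/forallP.
exists [ffun v => xchoose (ex' v)]; apply/ffunP => x; rewrite !ffunE /translation ffunE.
have /forallP/(_ (u x).2)/eqP <- := xchooseP (ex' (u x).1).
by rewrite -hr -surjective_pairing uK.
Qed.

Lemma card_pairing (Q : pred {ffun edge_end G -> edge_end G}) :
  #|[set p | pairing p && Q p]| = #|[set t | Q (pairing_of t)]|.
Proof.
rewrite -(card_imset _ pairing_of_inj); congr #|pred_of_set _|; apply/setP => p.
rewrite inE; apply/andP/imsetP => [[/pairingP[t ->] q] | [t + ->]].
  by exists t; rewrite ?inE.
by rewrite inE pairing_pairing_of.
Qed.

Lemma single_trail_pairing_of t :
  single_trail (pairing_of t) = joined (u \o @opp_end G \o u') (translation t).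
Proof.
rewrite single_trailE ?pairing_pairing_of //.
by apply: (joined_conj uK u'K) => x; rewrite /= ?uK // ffunE u'K.
Qed.

Lemma num_eulerian_toursE :
  num_eulerian_tours G =
  #|[set t : {ffun V -> option bool} | joined (u \o @opp_end G \o u') (translation t)]|.
Proof.
rewrite /num_eulerian_tours card_pairing.
by apply: eq_card => t; rewrite !inE single_trail_pairing_of.
Qed.

End Count.

Lemma num_A_trailsE (M : rmap) (V : finType)
    (u : edge_end M -> V * (bool * bool)) (u' : V * (bool * bool) -> edge_end M) :
  cancel u u' -> cancel u' u ->
  (forall x y, ((u x).1 == (u y).1) = (endv x == endv y)) ->
  (forall x, rotation M (endv x) = [seq u' ((u x).1, j) | j <- gray]) ->
  num_A_trails M =
  #|[set t : {ffun V -> option bool} |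
     joined (u \o @opp_end M \o u') (translation t) && [forall v, t v != None]]|.
Proof.
move=> uK u'K hv hr.
transitivity #|[set p : {ffun edge_end M -> edge_end M} | pairing p &&
    (single_trail p && [forall x, cyclicly_adjacent (rotation M (endv x)) x (p x)])]|.
  by apply: eq_card => p; rewrite !inE /A_trail /eulerian_tour -andbA.
rewrite (card_pairing uK u'K hv).
apply: eq_card => t; rewrite !inE (single_trail_pairing_of uK u'K hv); congr (_ && _).
(* Adjacency of an end and its partner depends only on the shift at their vertex, so testing one end
   per vertex suffices. *)
have adj x : cyclicly_adjacent (rotation M (endv x)) x (pairing_of u u' t x) = (t (u x).1 != None).
  rewrite hr ffunE /translation -(cyclicly_adjacent_gray (t (u x).1) (u x).2).
  rewrite -(@cyclicly_adjacent_map _ _ (fun j => u' ((u x).1, j)) gray) //=; last first.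
    by move=> j k /(can_inj u'K) [].
  by rewrite -surjective_pairing uK.
apply/forallP/forallP => h; last by move=> x; rewrite adj h.
by move=> v; have := h (u' (v, (false, false))); rewrite adj u'K.
Qed.

(** * The gadget *)

(** The gadget has vertices [Some false], [Some true] and [None], each with
    four positions.  [gadget_cell] tells which of the four outer ends, or which
    end of which inner edge, sits at a position. *)
Definition gadget_outer (j : bool * bool) : option bool * (bool * bool) :=
  match j with
  | (false, b) => (Some b, (false, false))
  | (true, b) => (None, (b, ~~ b))
  end.

(** The indices [(false, c)] are the parallel edges [e1]-[f1] and [e2]-[f2] between [Some false] and
    [Some true]; [(true, c)] joins [Some c] to [None], as [q]-[q'] or [s]-[s']. *)
Definition gadget_inner (i : bool * bool) (b : bool) : option bool * (bool * bool) :=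
  match i with
  | (false, c) => (Some b, (true, c))
  | (true, c) => if b then (None, (c, c)) else (Some c, (false, true))
  end.

Definition gadget_cell (w : option bool * (bool * bool)) :
    (bool * bool) + (bool * bool) * bool :=
  match w with
  | (Some b, (true, c)) => inr (false, c, b)
  | (Some c, (false, true)) => inr (true, c, false)
  | (Some b, (false, false)) => inl (false, b)
  | (None, (b, c)) => if b == c then inr (true, c, true) else inl (true, b)
  end.

Lemma gadget_outerK j : gadget_cell (gadget_outer j) = inl j.
Proof. by case: j => [[] []]. Qed.

Lemma gadget_innerK i b : gadget_cell (gadget_inner i b) = inr (i, b).
Proof. by case: i => [[] []]; case: b. Qed.

Lemma gadget_cellK w :
  match gadget_cell w with inl j => gadget_outer j | inr (i, b) => gadget_inner i b end = w.
Proof. by case: w => [[[]|] [[] []]]. Qed.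

Section Gadget.
Variables (V : finType) (o : V * (bool * bool) -> V * (bool * bool)).

Definition gadget_opp (x : V * option bool * (bool * bool)) : V * option bool * (bool * bool) :=
  let: (v, k, j) := x in
  match gadget_cell (k, j) with
  | inl j1 => let: (v2, j2) := o (v, j1) in (v2, (gadget_outer j2).1, (gadget_outer j2).2)
  | inr (i, b) => (v, (gadget_inner i (~~ b)).1, (gadget_inner i (~~ b)).2)
  end.

(** The shifts at the three gadget vertices that link the outer ends as
    [shift c] does and leave no closed trail inside; [b] tells apart the two
    ways of doing so. *)
Definition gadget_state (c : option bool) (b : bool) (k : option bool) : bool :=
  match c, k with
  | Some false, Some _ => true
  | Some false, None => b
  | _, Some e => e (+) b
  | _, None => c == None
  end.

Lemma gadget_state_inj c b c' b' :
  gadget_state c b =1 gadget_state c' b' -> (c, b) = (c', b').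
Proof.
move=> h; have := h None; have := h (Some true); have := h (Some false).
by case: c {h} => [[]|]; case: c' => [[]|]; case: b; case: b'.
Qed.

(** In the second case [e1] is paired with [e2] and [f1] with [f2], so the two parallel edges close
    up; the other six states are the values of [gadget_state]. *)
Lemma gadget_state_or_closed (s : option bool -> bool) :
  (exists c b, s =1 gadget_state c b) \/ (forall b, s (Some b) = false).
Proof.
case e0: (s (Some false)); case e1: (s (Some true)); case e2: (s None).
all: try by right => -[].
all: left.
- by exists (Some false), true => -[[]|].
- by exists (Some false), false => -[[]|].
- by exists None, true => -[[]|].
- by exists (Some true), true => -[[]|].
- by exists None, false => -[[]|].
- by exists (Some true), false => -[[]|].
Qed.

(** Follows the trail through the gadget out of a position up to an outer end. *)
Fixpoint gadget_walk (s : option bool -> bool) (n : nat) (w : option bool * (bool * bool)) :=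
  match gadget_cell (w.1, shift (Some (s w.1)) w.2), n with
  | inl j, _ => j
  | inr (i, b), n'.+1 => gadget_walk s n' (gadget_inner i (~~ b))
  | inr _, 0 => (false, false)
  end.

(** In these states every inner trail runs between two outer ends, linked as by [shift c], and an
    invariant colouring is constant along it. This restricts colourings to outer ends. *)
Lemma gadget_colouring c b (h : option bool * (bool * bool) -> bool) :
  (forall w, h (w.1, shift (Some (gadget_state c b w.1)) w.2) = h w) ->
  (forall i e, h (gadget_inner i (~~ e)) = h (gadget_inner i e)) ->
  (forall w, exists j, h w = h (gadget_outer j)) /\
  (forall j, h (gadget_outer (shift c j)) = h (gadget_outer j)).
Proof.
move=> h_shift h_inner.
have := h_inner (false, false) false; have := h_inner (false, true) false.
have := h_inner (true, false) false; have := h_inner (true, true) false.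
have := h_shift (Some false, (false, false)); have := h_shift (Some false, (false, true)).
have := h_shift (Some false, (true, false)); have := h_shift (Some false, (true, true)).
have := h_shift (Some true, (false, false)); have := h_shift (Some true, (false, true)).
have := h_shift (Some true, (true, false)); have := h_shift (Some true, (true, true)).
have := h_shift (None, (false, false)); have := h_shift (None, (false, true)).
have := h_shift (None, (true, false)); have := h_shift (None, (true, true)).
clear => *; split => [w | j].
  (* A trail meets at most four inner edges, so fuel 5 never runs out. *)
  exists (gadget_walk (gadget_state c b) 5 w).
  by destruct c as [[]|], b, w as [[[]|] [[] []]]; simpl in *; congruence.
by destruct c as [[]|], b, j as [[] []]; simpl in *; congruence.
Qed.

Lemma joined_gadget (t : {ffun V -> option bool}) (b : {ffun V -> bool})
    (s : {ffun V * option bool -> option bool}) :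
  (forall v k, s (v, k) = Some (gadget_state (t v) (b v) k)) ->
  joined gadget_opp (translation s) = joined o (translation t).
Proof.
move=> hs; apply/joinedP/joinedP => J f fo fp.
  (* Extends [f] inwards: each position takes the colour of the outer end that its trail reaches. *)
  pose f' (x : V * option bool * (bool * bool)) :=
    let: (v, k, j) := x in f (v, gadget_walk (gadget_state (t v) (b v)) 5 (k, j)).
  have fp' v j : f (v, shift (t v) j) = f (v, j) by exact: (fp (v, j)).
  (* From [gadget_outer j] the walk crosses the gadget and ends at [shift (t v) j], not at [j]; by
     [fp'] both have the same colour. *)
  have f'_outer v j : f' (v, (gadget_outer j).1, (gadget_outer j).2) = f (v, j).
    have := fp' v j; rewrite /f'.
    by case: (t v) => [[]|]; case: (b v); case: j => [[] []] //=.
  move=> [v j] [w j']; rewrite -!f'_outer; apply: J => -[[v1 k] j1].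
    rewrite /gadget_opp; case ec: (gadget_cell (k, j1)) => [i|[i c]].
      have := gadget_cellK (k, j1); rewrite ec => e.
      case eo: (o (v1, i)) => [v2 j2]; rewrite f'_outer -eo fo -f'_outer.
      by rewrite e.
    have := gadget_cellK (k, j1); rewrite ec => e; rewrite /f' -surjective_pairing.
    rewrite -{}e {ec}.
    have := fp' v1 (false, false); have := fp' v1 (false, true).
    have := fp' v1 (true, false); have := fp' v1 (true, true).
    by case: (t v1) => [[]|]; case: (b v1); case: i => [[] []]; case: c => /=.
  rewrite /f' /translation /= hs.
  have := fp' v1 (false, false); have := fp' v1 (false, true).
  have := fp' v1 (true, false); have := fp' v1 (true, true).
  by case: (t v1) => [[]|]; case: (b v1); case: k => [[]|]; case: j1 => [[] []] /=.
pose g v w := f (v, w.1, w.2).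
have g_shift v w : g v (w.1, shift (Some (gadget_state (t v) (b v) w.1)) w.2) = g v w.
  by rewrite /g -hs; exact: (fp (v, w.1, w.2)).
have g_inner v i c : g v (gadget_inner i (~~ c)) = g v (gadget_inner i c).
  have := fo (v, (gadget_inner i c).1, (gadget_inner i c).2).
  by rewrite /gadget_opp -surjective_pairing gadget_innerK.
have to_outer v w : exists j, g v w = g v (gadget_outer j).
  by have [] := gadget_colouring (g_shift v) (g_inner v).
have outer v1 j1 v2 j2 : g v1 (gadget_outer j1) = g v2 (gadget_outer j2).
  pose f0 z := g z.1 (gadget_outer z.2).
  apply: (J f0 _ _ (v1, j1) (v2, j2)) => -[v j]; rewrite /f0 /=.
    have := fo (v, (gadget_outer j).1, (gadget_outer j).2).
    rewrite /gadget_opp -surjective_pairing gadget_outerK.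
    by case: (o (v, j)) => v' j'.
  by have [] := gadget_colouring (g_shift v) (g_inner v).
move=> [[v k] j] [[v2 k2] j2]; rewrite -[LHS]/(g v (k, j)) -[RHS]/(g v2 (k2, j2)).
by have [j1 ->] := to_outer v (k, j); have [j3 ->] := to_outer v2 (k2, j2).
Qed.

Lemma joined_gadget_closed (v : V) (s : {ffun V * option bool -> option bool}) :
  (forall b, s (v, Some b) = Some false) -> ~~ joined gadget_opp (translation s).
Proof.
move=> hs; apply/negP => /joinedP J.
(* Marks exactly the ends [e1], [e2], [f1], [f2] in the gadget of [v], which form a closed trail of
   their own here. *)
pose f (x : V * option bool * (bool * bool)) := [&& x.1.1 == v, x.1.2 != None & x.2.1].
have : f (v, Some false, (true, false)) = f (v, None, (true, false)).
  apply: J => -[[v1 k] j].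
    rewrite /gadget_opp; case ec: (gadget_cell (k, j)) => [i|[i c]]; last first.
      have := gadget_cellK (k, j); rewrite ec /f.
      by case: i c {ec} => [[] []] [] /= [<- <-].
    have := gadget_cellK (k, j); rewrite ec /f; case: (o (v1, i)) => v2 j2.
    by case: i {ec} => [[] ?] /= [<- <-]; case: j2 => [[] ?]; rewrite /= ?andbF.
  rewrite /f /=; case: eqP => // ->; case: k => // b; by rewrite hs.
by rewrite /f /= eqxx.
Qed.

(** Every pairing at a vertex is realised by exactly two states of its gadget. *)
Lemma card_joined_gadget :
  #|[set s : {ffun V * option bool -> option bool} |
     joined gadget_opp (translation s) && [forall x, s x != None]]| =
  2 ^ #|V| * #|[set t : {ffun V -> option bool} | joined o (translation t)]|.
Proof.
(* The extra bit at each vertex chooses between the two states inducing the same pairing; these bits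
   account for the factor [2 ^ #|V|]. *)
pose F (x : {ffun V -> option bool} * {ffun V -> bool}) : {ffun V * option bool -> option bool} :=
  [ffun y => Some (gadget_state (x.1 y.1) (x.2 y.1) y.2)].
have F_inj : injective F.
  move=> [t b] [t' b'] /ffunP h.
  have tb v : (t v, b v) = (t' v, b' v).
    by apply: gadget_state_inj => k; have := h (v, k); rewrite !ffunE => -[].
  by congr pair; apply/ffunP => v; have [] := tb v.
rewrite -card_bool -card_ffun mulnC -[#|{: {ffun _ -> _}}|]cardsT -cardsX -(card_imset _ F_inj).
congr #|pred_of_set _|; apply/setP => s; rewrite inE.
apply/andP/imsetP => [[js /forallP hs] | [[t b]]]; last first.
  rewrite !inE /= andbT => jt ->; split; last by apply/forallP => x; rewrite ffunE.
  by rewrite (@joined_gadget t b) // => v k; rewrite ffunE.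
pose e v k := s (v, k) == Some true.
have se v k : s (v, k) = Some (e v k).
  by rewrite /e; move: (hs (v, k)); case: (s (v, k)) => [[]|].
have ex v : exists x, [forall k, e v k == gadget_state x.1 x.2 k].
  case: (gadget_state_or_closed (e v)) => [[c [b h]]|h].
    by exists (c, b); apply/forallP => k; rewrite h.
  by have /negP[] :=
    @joined_gadget_closed v s (fun b => etrans (se v (Some b)) (congr1 Some (h b))).
pose x v := xchoose (ex v).
have hx v k : e v k = gadget_state (x v).1 (x v).2 k.
  by have /forallP/(_ k)/eqP := xchooseP (ex v).
exists ([ffun v => (x v).1], [ffun v => (x v).2]); last first.
  by apply/ffunP => -[v k]; rewrite !ffunE se hx.
rewrite !inE /= andbT -(@joined_gadget _ [ffun v => (x v).2] s) // => v k.
by rewrite !ffunE se hx.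
Qed.

End Gadget.

(** * The gadget map *)

(** Division with remainder by [k]; it numbers the gadget vertices with [k = 3] and the inner edges
    with [k = 4]. *)
Lemma bij_block_ord (n k : nat) (T : finType) (num : T -> nat) :
  injective num -> (forall j, num j < k) -> #|T| = k ->
  exists2 g : 'I_n * T -> 'I_(n * k),
    bijective g & forall v j, g (v, j) = v * k + num j :> nat.
Proof.
move=> num_inj num_lt cardT.
have lt (x : 'I_n * T) : x.1 * k + num x.2 < n * k.
  by case: x => v j /=; have := num_lt j; have := ltn_ord v; nia.
exists (fun x => Ordinal (lt x)) => //; apply: inj_card_bij; last first.
  by rewrite card_prod !card_ord cardT.
move=> [v j] [v' j'] /(congr1 val) /= h.
have k_gt0 : 0 < k by apply: leq_ltn_trans (num_lt j).
have ev : v = v'.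
  by apply: val_inj; move: (congr1 (divn^~ k) h); rewrite /= !divnMDl // !divn_small // !addn0.
by move: h; rewrite ev => /addnI /num_inj ->.
Qed.

Lemma nth_flatten_block (T : Type) (x0 : T) (n k : nat) (F : 'I_n -> seq T) (i : 'I_n) (j : nat) :
  (forall i, size (F i) = k) -> j < k ->
  nth x0 (flatten [seq F i | i <- enum 'I_n]) (i * k + j) = nth x0 (F i) j.
Proof.
move=> szF jk; set ss := map F _.
have shE : shape ss = nseq n k.
  rewrite /ss /shape -map_comp -[in RHS](size_enum_ord n).
  by elim: (enum _) => //= a s ->; rewrite szF.
have -> : i * k + j = flatten_index (shape ss) i j.
  rewrite /flatten_index shE take_nseq ?sumn_nseq; last exact: ltnW.
  by rewrite mulnC.
rewrite nth_flatten flatten_indexKl ?flatten_indexKr ?shE ?nth_nseq ?ltn_ord //.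
by rewrite (nth_map i) ?size_enum_ord // nth_ord_enum.
Qed.

Lemma size_flatten_block (T : Type) (n k : nat) (F : 'I_n -> seq T) :
  (forall i, size (F i) = k) -> size (flatten [seq F i | i <- enum 'I_n]) = n * k.
Proof.
move=> szF; rewrite size_flatten /shape -map_comp -[in RHS](size_enum_ord n).
by elim: (enum _) => //= a s ->; rewrite szF mulSn.
Qed.

Lemma code_end_lt (G : multigraph) (x : edge_end G) : code_end x < ne G * 2.
Proof. by case: x => e b; rewrite /code_end /=; have := ltn_ord e; case: b; lia. Qed.

Lemma code_end_surj (G : multigraph) (k : nat) :
  k < ne G * 2 -> exists x : edge_end G, code_end x = k.
Proof.
move=> hk; have lt : k./2 < ne G by lia.
by exists (Ordinal lt, odd k); rewrite /code_end /= addnC odd_double_half.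
Qed.

Lemma size_code_graph (G : multigraph) : size (code_graph G) = 2 + ne G * 2.
Proof. by rewrite /= (@size_flatten_block _ _ 2). Qed.

Lemma nth_code_graph_end (G : multigraph) (x : edge_end G) :
  nth 0 (code_graph G) (2 + code_end x) = endv x.
Proof.
case: x => e b; rewrite /code_graph /code_end /= -muln2.
by rewrite (@nth_flatten_block _ 0 _ 2) ?ltnS ?leq_b1 //; case: b.
Qed.

Lemma mkseq_code_map (M : rmap) (out : nat -> nat) :
  four_regular M ->
  out 0 = nv M -> out 1 = ne M ->
  (forall x : edge_end M, out (2 + code_end x) = endv x) ->
  (forall (v : 'I_(nv M)) (j : nat), j < 4 ->
     out (2 + ne M * 2 + (v * 4 + j)) = nth 0 [seq code_end x | x <- rotation M v] j) ->
  mkseq out (2 + ne M * 2 + nv M * 4) = code_map M.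
Proof.
move=> /forallP reg o0 o1 oe orot.
have szr v : size [seq code_end x | x <- rotation M v] = 4.
  by rewrite size_map size_rotation; apply/eqP.
apply: (@eq_from_nth _ 0).
  by rewrite size_mkseq size_cat size_code_graph (@size_flatten_block _ _ 4).
move=> i; rewrite size_mkseq => hi; rewrite nth_mkseq // nth_cat size_code_graph.
case: ltnP => h.
  case: i h {hi} => [|[|i]] // h; have hi : i < ne M * 2 by lia.
  by have [x <-] := code_end_surj hi; rewrite oe nth_code_graph_end.
have lt : (i - (2 + ne M * 2)) %/ 4 < nv M by rewrite ltn_divLR //; lia.
set z := i - _ in lt *; rewrite (_ : i = 2 + ne M * 2 + z); last by lia.
rewrite (divn_eq z 4) (orot (Ordinal lt)) ?ltn_mod //.
by rewrite (@nth_flatten_block _ 0 _ 4 _ (Ordinal lt)) ?ltn_mod.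
Qed.

(** * Numbering the edge-ends and placing them around the gadget vertices *)

Section Placement.
Variable G : multigraph.
Notation n := (nv G).
Notation m := (ne G).

(** When [w] is the vertex of the end numbered [k], this is the rank of that end there, deciding
    which of [a], [b], [c], [d] it becomes. Letting [k] vary allows computing it by a running
    counter. *)
Definition ends_before (w k : nat) : nat :=
  #|[set y : edge_end G | (val (endv y) == w) && (code_end y < k)]|.

(** The ends of the gadget map numbered [2 m + 8 v + r] with [r < 8] are the
    inner ends of the gadget of [v]; the ends of [G] keep their numbers.  The
    end numbered [k] sits at position [p %% 4] around vertex [p %/ 4] for
    [p = place k]. *)
Definition outer_place : nat -> nat := nth 0 [:: 0; 4; 9; 11].
Definition inner_place : nat -> nat := nth 0 [:: 3; 7; 2; 6; 1; 8; 5; 10].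
Definition place (k : nat) : nat :=
  if k < m * 2 then
    let w := nth 0 (code_graph G) (2 + k) in 12 * w + outer_place (ends_before w k)
  else 12 * ((k - m * 2) %/ 8) + inner_place ((k - m * 2) %% 8).

Hypothesis reg : four_regular G.

Lemma card_edge_end : #|edge_end G| = n * 4.
Proof.
rewrite -sum1_card (partition_big (@endv G) predT) //=.
rewrite (eq_bigr (fun=> 4)) ?sum_nat_const ?card_ord // => v _.
rewrite sum1dep_card; have /forallP/(_ v)/eqP <- := reg.
by apply: eq_card => x; rewrite !inE.
Qed.

Lemma ends_before_lt4 (x : edge_end G) : ends_before (endv x) (code_end x) < 4.
Proof.
have /forallP/(_ (endv x))/eqP <- := reg; apply: proper_card; apply/properP; split.
  by apply/subsetP => y; rewrite !inE => /andP[].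
by exists x; rewrite !inE ?eqxx ?ltnn.
Qed.

Lemma ends_before_lt (x y : edge_end G) :
  endv x = endv y -> code_end x < code_end y ->
  ends_before (endv x) (code_end x) < ends_before (endv y) (code_end y).
Proof.
move=> exy lt; apply: proper_card; apply/properP; split.
  by apply/subsetP => z; rewrite !inE exy => /andP[-> h]; apply: ltn_trans lt.
by exists x; rewrite !inE exy ?eqxx ?ltnn.
Qed.

Definition end_coord (x : edge_end G) : 'I_n * (bool * bool) :=
  let s := ends_before (endv x) (code_end x) in (endv x, (1 < s, odd s)).

(** Ranks at a vertex are below four and strictly increase with the code, so vertex and rank
    determine the end; the cardinalities agree by degree counting. *)
Lemma end_coord_bij : bijective end_coord.
Proof.
apply: inj_card_bij; last by rewrite card_edge_end !card_prod card_bool card_ord.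
move=> x y [/[dup] exy -> h1 h2].
have hs : ends_before (endv x) (code_end x) = ends_before (endv y) (code_end y).
  have := ends_before_lt4 x; have := ends_before_lt4 y; move: h1 h2; rewrite exy.
  by move: (ends_before _ _) (ends_before _ _) => [|[|[|[|a]]]] [|[|[|[|b]]]].
apply: code_end_inj; case: (ltngtP (code_end x) (code_end y)) => // lt.
  by have := ends_before_lt exy lt; rewrite hs ltnn.
by have := ends_before_lt (esym exy) lt; rewrite hs ltnn.
Qed.

End Placement.

Section GadgetMap.
Variable G : multigraph.
Hypothesis reg : four_regular G.
Notation n := (nv G).
Notation m := (ne G).

Notation gend := (edge_end G + 'I_n * (bool * bool) * bool)%type.

Definition bits_val (i : bool * bool) : nat := 2 * i.1 + i.2.
Definition gray_val (j : bool * bool) : nat := index j gray.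
Definition corner_val (k : option bool) : nat := if k is Some b then b else 2.

Definition gend_code (y : gend) : nat :=
  match y with
  | inl x => code_end x
  | inr (v, i, b) => m * 2 + 8 * v + (2 * bits_val i + b)
  end.

Definition gend_coord (y : gend) : 'I_n * option bool * (bool * bool) :=
  match y with
  | inl x => let: (v, j) := end_coord x in (v, (gadget_outer j).1, (gadget_outer j).2)
  | inr (v, i, b) => (v, (gadget_inner i b).1, (gadget_inner i b).2)
  end.

Definition gend_opp (y : gend) : gend :=
  match y with
  | inl x => inl (opp_end x)
  | inr (v, i, b) => inr (v, i, ~~ b)
  end.

Definition coord_val (c : 'I_n * option bool * (bool * bool)) : nat :=
  12 * c.1.1 + 4 * corner_val c.1.2 + gray_val c.2.

Lemma coord_val_inj : injective coord_val.
Proof.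
move=> [[v k] j] [[v' k'] j']; rewrite /coord_val /= => h.
have ev : v = v'.
  apply: val_inj; move: h; clear.
  by case: k => [[]|]; case: k' => [[]|]; case: j => [[] []]; case: j' => [[] []];
    rewrite /gray_val /=; lia.
subst v'; move: h; rewrite -!addnA => /addnI.
by case: k => [[]|]; case: k' => [[]|]; case: j => [[] []]; case: j' => [[] []];
  rewrite /gray_val //=; lia.
Qed.

Lemma coord_val_lt c : coord_val c < n * 12.
Proof.
case: c => [[v k] j]; rewrite /coord_val /=; have := ltn_ord v.
by case: k => [[]|]; case: j => [[] []]; rewrite /gray_val /=; lia.
Qed.

(** Checks the tables against the gadget: entries are four times the corner number plus the index in
    [gray], for [a, b, c, d] in [outer_place] and [e1, f1, e2, f2, q, q', s, s'] in
    [inner_place]. *)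
Lemma place_gend_code (y : gend) : place G (gend_code y) = coord_val (gend_coord y).
Proof.
case: y => [x|[[v i] b]]; rewrite /place /=.
  rewrite code_end_lt [X in 12 * X](nth_code_graph_end x).
  rewrite [X in ends_before G X _](nth_code_graph_end x).
  rewrite /coord_val /end_coord /=; have := ends_before_lt4 reg x.
  by case: (ends_before _ _ _) => [|[|[|[|]]]] //= _; rewrite -addnA.
rewrite ifN; last by rewrite -leqNgt; lia.
have r_lt : 2 * bits_val i + b < 8 by case: i => [[] []]; case: b.
rewrite -addnA addKn [8 * v]mulnC divnMDl // modnMDl divn_small // modn_small // addn0.
rewrite /coord_val /= -addnA; congr (_ + _).
by case: i {r_lt} => [[] []]; case: b.
Qed.

Lemma ne4 : m * 2 = n * 4.
Proof. by rewrite -(card_edge_end reg) card_prod card_ord card_bool. Qed.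

Lemma gend_codeP k : k < n * 12 -> exists y, gend_code y = k.
Proof.
move=> hk; case: (ltnP k (m * 2)) => h.
  by have [x <-] := code_end_surj h; exists (inl x).
have hv : (k - m * 2) %/ 8 < n by rewrite ltn_divLR //; have := ne4; lia.
have [i [b e]] : exists i (b : bool), 2 * bits_val i + b = (k - m * 2) %% 8.
  have : (k - m * 2) %% 8 < 8 by rewrite ltn_mod.
  move: (_ %% 8) => r; clear; do 8?[case: r => [|r]] => // _.
  - by exists (false, false), false.
  - by exists (false, false), true.
  - by exists (false, true), false.
  - by exists (false, true), true.
  - by exists (true, false), false.
  - by exists (true, false), true.
  - by exists (true, true), false.
  - by exists (true, true), true.
by exists (inr (Ordinal hv, i, b)); rewrite /gend_code e /=; lia.
Qed.

Lemma place_lt k : k < n * 12 -> place G k < n * 12.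
Proof. by move=> /gend_codeP[y <-]; rewrite place_gend_code coord_val_lt. Qed.

Lemma gend_coord_bij : bijective gend_coord.
Proof.
have [e' eK e'K] := end_coord_bij reg.
exists (fun c => match gadget_cell (c.1.2, c.2) with
  | inl j => inl (e' (c.1.1, j))
  | inr (i, b) => inr (c.1.1, i, b)
  end).
  move=> [x|[[v i] b]]; last by case: i => [[] []]; case: b.
  rewrite /gend_coord; case ex: (end_coord x) => [v j].
  by have <- : e' (v, j) = x; [rewrite -ex eK | case: j {ex} => [[] []]].
move=> [[v k] j]; rewrite -[(_, _).1.2]/k; have := gadget_cellK (k, j).
by case: (gadget_cell _) => [i|[i b]] e; rewrite /gend_coord ?e'K e.
Qed.

(** Ensures that the rotation entries written for different ends never overwrite each other. *)
Lemma place_inj : {in [pred k | k < n * 12] &, injective (place G)}.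
Proof.
move=> k k'; rewrite !inE => /gend_codeP[y <-] /gend_codeP[y' <-].
by rewrite !place_gend_code => /coord_val_inj /(bij_inj gend_coord_bij) ->.
Qed.

(** The last clause describes the code of [M] cell by cell, so that it can be filled one end at a
    time: the rotation part is the inverse table of [place G]. *)
Lemma gadget_map :
  exists M : rmap,
  [/\ four_regular M,
      num_A_trails M = 2 ^ n * num_eulerian_tours G
    & forall out : nat -> nat,
      out 0 = 3 * n -> out 1 = m + 4 * n ->
      (forall k, k < n * 12 -> out (2 + k) = place G k %/ 4 /\
                               out (2 + n * 12 + place G k) = k) ->
      mkseq out (2 + n * 24) = code_map M].
Proof.
have [e' eK e'K] := end_coord_bij reg.
have [l' lK l'K] := gend_coord_bij.
have bits_inj : injective bits_val by case=> [[] []] [[] []].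
have bits_lt i : bits_val i < 4 by case: i => [[] []].
have corner_inj : injective corner_val by case=> [[]|] [[]|].
have corner_lt k : corner_val k < 3 by case: k => [[]|].
have card_bits : #|{: bool * bool}| = 4 by rewrite card_prod card_bool.
have card_corner : #|{: option bool}| = 3 by rewrite card_option card_bool.
have [g4 [g4' g4K g4'K] g4E] := @bij_block_ord n 4 _ _ bits_inj bits_lt card_bits.
have [g3 [g3' g3K g3'K] g3E] := @bij_block_ord n 3 _ _ corner_inj corner_lt card_corner.
(* Edges of [G] keep their numbers and the inner edges follow, so that codes in the new graph agree
   with [gend_code]. *)
pose h (y : gend) : 'I_(m + n * 4) * bool :=
  match y with
  | inl x => (lshift _ x.1, x.2)
  | inr (v, i, b) => (rshift _ (g4 (v, i)), b)
  end.
pose h' (x : 'I_(m + n * 4) * bool) : gend :=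
  match split x.1 with
  | inl e => inl (e, x.2)
  | inr q => inr (g4' q, x.2)
  end.
have hK : cancel h h'.
  move=> [[e b]|[[v i] b]]; rewrite /h /h' /=.
    by rewrite (unsplitK (inl e)).
  by rewrite (unsplitK (inr (g4 (v, i)))) g4K.
have h'K : cancel h' h.
  move=> [e b]; rewrite /h /h' /=; have := splitK e.
  by case: (split e) => q /= <- //; case eq: (g4' q) => [v i]; rewrite -eq g4'K.
pose G' := @Multigraph (n * 3) (m + n * 4) [ffun x => g3 (gend_coord (h' x)).1].
have endvE y : @endv G' (h y) = g3 (gend_coord y).1 by rewrite /endv /= ffunE hK.
pose rot (w : 'I_(nv G')) : seq (edge_end G') := [seq h (l' (g3' w, j)) | j <- gray].
have rotP : [forall w, perm_eq ([ffun w => rot w] w) (enum (ends_at w))].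
  apply/forallP => w; rewrite ffunE; apply: uniq_perm.
  - by rewrite map_inj_uniq // => j k /(can_inj hK) /(can_inj l'K) [].
  - exact: enum_uniq.
  move=> x; rewrite mem_enum in_set -(h'K x) endvE; apply/mapP/eqP => [[j _ /(can_inj hK) ->]|ew].
    by rewrite l'K /= g3'K.
  exists (gend_coord (h' x)).2; first by case: (gend_coord (h' x)).2 => [[] []].
  by rewrite -ew g3K -surjective_pairing lK.
pose M := RMap rotP.
have regM : four_regular M.
  by apply/forallP => w; rewrite -(@size_rotation M) /= ffunE /rot size_map.
have oppE y : @opp_end M (h y) = h (gend_opp y) by case: y => [[e b]|[[v i] b]].
have endvM y : @endv M (h y) = g3 (gend_coord y).1 := endvE y.
pose u (x : edge_end M) := gend_coord (h' x); pose u' c : edge_end M := h (l' c).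
have uK : cancel u u' by move=> x; rewrite /u' /u lK h'K.
have u'K : cancel u' u by move=> x; rewrite /u' /u hK l'K.
have u_endv x y : ((u x).1 == (u y).1) = (@endv M x == @endv M y).
  by rewrite -{2}(h'K x) -{2}(h'K y) !endvM (can_eq g3K).
have u_rot x : rotation M (endv x) = [seq u' ((u x).1, j) | j <- gray].
  by rewrite -{1}(h'K x) endvM /= ffunE /rot g3K.
have nMA : num_A_trails M = 2 ^ n * num_eulerian_tours G.
  rewrite (@num_A_trailsE M ('I_n * option bool)%type u u' uK u'K u_endv u_rot).
  rewrite (@num_eulerian_toursE G 'I_n _ e' eK e'K) //.
  (* It remains to check that in the coordinates [u] the edge involution of [M] is [gadget_opp] of
     the one of [G]. *)
  have := card_joined_gadget (end_coord (G:=G) \o @opp_end G \o e'); rewrite card_ord => <-.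
  apply: eq_card => s; rewrite !inE; congr (_ && _).
  apply: (@joined_conj _ _ id id) => // c.
  rewrite -[RHS]/(gend_coord (h' (@opp_end M (h (l' c))))) -[X in gadget_opp _ X]/c.
  rewrite oppE hK; have := l'K c; case: (l' c) => [x|[[v1 i] b]] <-.
    rewrite /gend_opp /gend_coord.
    case ex: (end_coord x) => [v1 j1].
    rewrite /gadget_opp -surjective_pairing gadget_outerK.
    by rewrite -[(_ \o _) _]/(end_coord (opp_end (e' (v1, j1)))) -ex eK.
  by rewrite /gadget_opp /gend_coord -surjective_pairing gadget_innerK.
exists M; split=> // out o0 o1 ho.
have codeE y : @code_end M (h y) = gend_code y.
  case: y => [[e b]|[[v i] b]]; rewrite /code_end //= g4E -!muln2; lia.
have lt12 y : gend_code y < n * 12.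
  by rewrite -codeE; have := @code_end_lt M (h y); rewrite /=; have := ne4; lia.
have e24 : 2 + n * 24 = 2 + ne M * 2 + nv M * 4 by rewrite /=; have := ne4; lia.
rewrite {}e24; apply: mkseq_code_map => //.
- by rewrite o0 /= mulnC.
- by rewrite o1 /= mulnC.
- move=> x; rewrite -(h'K x) codeE endvM; have [-> _] := ho _ (lt12 (h' x)).
  rewrite place_gend_code; case: (gend_coord (h' x)) => [[v k] j].
  have j_lt : gray_val j < 4 by case: j => [[] []].
  by rewrite g3E /coord_val /=; lia.
move=> w j hj; rewrite /= ffunE /rot -map_comp (nth_map (false, false)) //=.
pose c := (g3' w, nth (false, false) gray j).
rewrite -[X in _ = X]/(@code_end M (h (l' c))) codeE.
have [_ <-] := ho _ (lt12 (l' c)).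
rewrite place_gend_code l'K -{1}(g3'K w) /coord_val /c.
have -> : gray_val (nth (false, false) gray j) = j by case: j hj {c} => [|[|[|[|]]]].
congr out; case: (g3' w) => v k; rewrite g3E /=; have := ne4; lia.
Qed.

End GadgetMap.

(** There are three pairings at each vertex. The bound controls the length of the oracle's
    answer. *)
Lemma num_eulerian_tours_le (G : multigraph) :
  four_regular G -> num_eulerian_tours G <= 3 ^ nv G.
Proof.
move=> reg; have [e' eK e'K] := end_coord_bij reg.
rewrite (@num_eulerian_toursE G 'I_(nv G) _ e' eK e'K) //.
apply: leq_trans (max_card _) _.
by rewrite card_ffun card_option card_bool card_ord.
Qed.

(** * Cost of programs *)

Lemma leq_bits k n : 0 < k -> n < 2 ^ k -> bits n <= k.
Proof.
move=> k_gt0 h; case: n h => [|n] h; first by rewrite /bits trunc_log0.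
rewrite /bits -(ltn_exp2l (trunc_log 2 n.+1) k (isT : 1 < 2)).
by apply: leq_ltn_trans h; exact: trunc_logP.
Qed.

Lemma ltn_2bits n : n < 2 ^ bits n.
Proof. exact: trunc_log_ltn. Qed.

Lemma bits_leS n : bits n <= n.+1.
Proof. by apply: leq_bits => //; apply: ltn_trans (ltnSn n) _; exact: ltn_expl. Qed.

Lemma leq_bits2 m n : m <= n -> bits m <= bits n.
Proof. by move=> h; apply: leq_bits => //; apply: leq_ltn_trans h (ltn_2bits n). Qed.

Lemma bitsD m n : bits (m + n) <= bits m + bits n.
Proof.
apply: leq_bits => //; rewrite expnD.
have := ltn_2bits m; have := ltn_2bits n; have : 1 < 2 ^ bits m by rewrite (ltn_exp2l 0).
have : 1 < 2 ^ bits n by rewrite (ltn_exp2l 0).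
move: (2 ^ _) (2 ^ _) => x y; nia.
Qed.

Lemma bitsM m n : bits (m * n) <= bits m + bits n.
Proof. by apply: leq_bits => //; rewrite expnD; apply: ltn_mul; exact: ltn_2bits. Qed.

(** Bits of the value and evaluation cost of an expression, in units of a bound
    [b > 0] on the number of bits of every cell. *)
Fixpoint esize (e : expr) : nat :=
  match e with
  | Cst n => bits n
  | Get _ _ => 1
  | Add e1 e2 | Sub e1 e2 | Mul e1 e2 | Div e1 e2 => esize e1 + esize e2
  end.

Fixpoint etime (e : expr) : nat :=
  esize e +
  match e with
  | Cst _ => 0
  | Get _ e1 => etime e1
  | Add e1 e2 | Sub e1 e2 | Mul e1 e2 | Div e1 e2 => etime e1 + etime e2
  end.

Definition bounded (b : nat) (s : store) : Prop := forall a i, bits (s a i) <= b.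

Lemma bits_eval b s e : 0 < b -> bounded b s -> bits (eval s e) <= esize e * b.
Proof.
move=> b_gt0 bs; elim: e => //= [n|a e _|e1 h1 e2 h2|e1 h1 e2 h2|e1 h1 e2 h2|e1 h1 e2 h2].
- by rewrite leq_pmulr.
- by rewrite mul1n.
- by rewrite mulnDl; apply: leq_trans (bitsD _ _) (leq_add h1 h2).
- rewrite mulnDl; apply: leq_trans (leq_trans h1 (leq_addr _ _)).
  exact/leq_bits2/leq_subr.
- by rewrite mulnDl; apply: leq_trans (bitsM _ _) (leq_add h1 h2).
- rewrite mulnDl; apply: leq_trans (leq_trans h1 (leq_addr _ _)).
  exact/leq_bits2/leq_div.
Qed.

Lemma ecost_le b s e : 0 < b -> bounded b s -> ecost s e <= etime e * b.
Proof.
move=> b_gt0 bs; have size_le e1 := bits_eval e1 b_gt0 bs.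
elim: e => [n|a e h|e1 h1 e2 h2|e1 h1 e2 h2|e1 h1 e2 h2|e1 h1 e2 h2];
  rewrite [ecost _ _]/= [etime _]/= ?addn0 ?[X in _ <= X]mulnDl ?leq_add //;
  first [exact: (size_le (Cst n)) | exact: (size_le (Get a e)) |
         by rewrite mulnDl leq_add | idtac].
- exact: (size_le (Add e1 e2)).
- exact: (size_le (Sub e1 e2)).
- exact: (size_le (Mul e1 e2)).
- exact: (size_le (Div e1 e2)).
Qed.

Lemma bounded_upd b s a i n : bounded b s -> bits n <= b -> bounded b (upd s a i n).
Proof. by move=> bs bn c j; rewrite /upd; case: ifP. Qed.

(** * A total-correctness logic with time bounds *)

Section ProgramLogic.
Variables (f : seq nat -> nat) (b : nat).
Hypothesis b_gt0 : 0 < b.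

(** Time is counted in units of [b], the bound on cell lengths; with boundedness carried along, each
    assignment costs a constant number of units. *)
Definition runs (c : prog) (s : store) (k : nat) (Q : store -> Prop) : Prop :=
  exists s' t, [/\ exec f c s s' t, t <= k * b, bounded b s' & Q s'].

Lemma runs_weaken c s k k' (Q Q' : store -> Prop) :
  k <= k' -> (forall s', Q s' -> Q' s') -> runs c s k Q -> runs c s k' Q'.
Proof.
move=> hk hQ [s' [t [e ht bs q]]]; exists s', t; split=> //; last exact: hQ.
by apply: leq_trans ht _; rewrite leq_mul2r hk orbT.
Qed.

Lemma runs_put a i e s (Q : store -> Prop) :
  bounded b s -> bits (eval s e) <= b -> Q (upd s a (eval s i) (eval s e)) ->
  runs (Put a i e) s (etime i + etime e) Q.
Proof.
move=> bs be q; exists (upd s a (eval s i) (eval s e)), (ecost s i + ecost s e).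
split=> //; [exact: ExecPut | | exact: bounded_upd].
by rewrite mulnDl leq_add ?ecost_le.
Qed.

Lemma runs_seq c1 c2 s k1 k2 (Q1 Q2 : store -> Prop) :
  runs c1 s k1 Q1 -> (forall s1, bounded b s1 -> Q1 s1 -> runs c2 s1 k2 Q2) ->
  runs (Seq c1 c2) s (k1 + k2) Q2.
Proof.
move=> [s1 [t1 [e1 h1 b1 q1]]] /(_ s1 b1 q1) [s2 [t2 [e2 h2 b2 q2]]].
by exists s2, (t1 + t2); split=> //; [exact: ExecSeq e1 e2 | rewrite mulnDl leq_add].
Qed.

(** Each queried cell costs at most one unit, and the answer one more. *)
Lemma runs_ask a l c s (Q : store -> Prop) :
  bounded b s -> bits (f (query s a (eval s l))) <= b ->
  Q (upd s c 0 (f (query s a (eval s l)))) ->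
  runs (Ask a l c) s (etime l + eval s l + 1) Q.
Proof.
move=> bs bf q; eexists; eexists; split; [exact: ExecAsk | | exact: bounded_upd | exact: q].
rewrite !mulnDl mul1n !leq_add ?ecost_le //.
rewrite /word_size big_map -[X in _ <= X * _](size_iota 0) -sum1_size big_distrl /=.
by apply: leq_sum => i _; rewrite mul1n.
Qed.

(** The invariant is indexed by the iterations done, so a test vanishing exactly at [i = n] gives
    termination and the iteration count at once. *)
Lemma runs_while e c s n kb (I : nat -> store -> Prop) :
  bounded b s -> I 0 s ->
  (forall i s, I i s -> (eval s e == 0) = (i == n)) ->
  (forall i s, i < n -> bounded b s -> I i s -> runs c s kb (I i.+1)) ->
  runs (While e c) s (n * (etime e + kb) + etime e) (I n).
Proof.
move=> bs I0 test step.
suff H d i s1 : i + d = n -> bounded b s1 -> I i s1 ->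
    runs (While e c) s1 (d * (etime e + kb) + etime e) (I n) by exact: (H n 0).
elim: d i s1 => [|d IH] i s1 hi b1 i1.
  exists s1, (ecost s1 e); rewrite -hi addn0; split=> //; last by rewrite ecost_le.
  by apply/ExecWhileFalse/eqP; rewrite (test _ _ i1); apply/eqP; rewrite -hi addn0.
have lt_in : i < n by rewrite -hi addnS ltnS leq_addr.
have [s2 [t2 [e2 h2 b2 i2]]] := step i s1 lt_in b1 i1.
have [|s3 [t3 [e3 h3 b3 i3]]] := IH i.+1 s2 _ b2 i2; first by rewrite addSnnS.
exists s3, (ecost s1 e + t2 + t3); split=> //.
  by apply: ExecWhileTrue e2 e3; rewrite (test _ _ i1) ltn_eqF.
rewrite mulSn -[X in _ <= X * _]addnA [X in _ <= X]mulnDl; apply: leq_add => //.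
by rewrite mulnDl leq_add // ecost_le.
Qed.

End ProgramLogic.

(** * The reduction *)

(** Meaningful for straight-line programs only; the value 0 elsewhere is a dummy, loops and the
    query being charged in [reduction_time]. *)
Fixpoint ptime (c : prog) : nat :=
  match c with
  | Skip => 1
  | Put _ i e => etime i + etime e
  | Seq c1 c2 => ptime c1 + ptime c2
  | _ => 0
  end.

Lemma runs_put_seq f b a i e c s (Q : store -> Prop) :
  0 < b -> bounded b s -> bits (eval s e) <= b ->
  (bounded b (upd s a (eval s i) (eval s e)) ->
   runs f b c (upd s a (eval s i) (eval s e)) (ptime c) Q) ->
  runs f b (Seq (Put a i e) c) s (ptime (Seq (Put a i e) c)) Q.
Proof.
move=> b_gt0 bs be h.
apply: (runs_seq (Q1 := fun s' => s' = upd s a (eval s i) (eval s e))).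
  exact: runs_put.
by move=> s1 b1 e1; rewrite e1 in b1 *; exact: h.
Qed.

Fixpoint put_seq (a i : nat) (w : seq nat) : prog :=
  if w is n :: w' then Seq (Put a (Cst i) (Cst n)) (put_seq a i.+1 w') else Skip.

Lemma runs_put_seq_table f b a i w s :
  0 < b -> bounded b s -> (forall n, n \in w -> bits n <= b) ->
  runs f b (put_seq a i w) s (ptime (put_seq a i w))
    (fun s' => forall c j,
       s' c j = if (c == a) && (i <= j < i + size w) then nth 0 w (j - i) else s c j).
Proof.
move=> b_gt0; elim: w i s => [|n w IH] i s bs bw.
  exists s, 1; split=> //; [exact: ExecSkip | by rewrite mul1n | move=> c j /=].
  by rewrite addn0 leqNgt andNb andbF.
apply: runs_put_seq => //= [|b1]; first by rewrite bw ?mem_head.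
apply: runs_weaken (leqnn _) _ (IH _ _ b1 _) => [s' hs' c j|k hk]; last first.
  by rewrite bw // inE hk orbT.
rewrite hs' /upd; case: eqP => //= _; rewrite addSnnS.
case: (ltngtP i j) => [h|h|->]; last by rewrite subnn addnS ltnS leq_addr.
  by rewrite -(subnSK h) /=.
by [].
Qed.

(** Codes are distinct, so passing [x] raises the count at its own vertex only; this justifies the
    counter update in [outer_body]. *)
Lemma ends_beforeS (G : multigraph) (x : edge_end G) w :
  ends_before G w (code_end x).+1 = ends_before G w (code_end x) + (val (endv x) == w).
Proof.
have code_lt (y : edge_end G) :
    (code_end y < (code_end x).+1) = (y == x) || (code_end y < code_end x).
  by rewrite ltnS leq_eqVlt (inj_eq (@code_end_inj G)).
rewrite /ends_before addnC; case: eqP => [<-|ne] /=.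
  set A := [set y | _ & code_end y < code_end x]; have xA : x \notin A by rewrite inE ltnn andbF.
  have := cardsU1 x A; rewrite xA /= => <-; apply: eq_card => y.
  by rewrite !inE code_lt; case: (y =P x) => [->|] //=; rewrite eqxx.
apply: eq_card => y; rewrite !inE code_lt.
by case: (y =P x) => [->|] //; case: eqP.
Qed.

(** Array 2 receives the query, array 3 the table [places], cell [v] of array 4
    the number of ends met so far at [v]; cell 0 of arrays 5, 6 and 7 holds the
    number of the current end, its place, and the number of halvings done. *)
Definition count_expr : expr := Get 0 (Cst 0).
Definition index_expr : expr := Get 5 (Cst 0).
Definition place_expr : expr := Get 6 (Cst 0).
Definition endv_expr : expr := Get 0 (Add (Cst 2) index_expr).
(** As [4 n = 2 m], this is the offset of the current end among the inner ends. *)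
Definition inner_index_expr : expr := Sub index_expr (Mul (Cst 4) count_expr).

Definition advance : prog := Put 5 (Cst 0) (Add index_expr (Cst 1)).

Definition record_place (c : prog) : prog :=
  Seq (Put 2 (Add (Cst 2) index_expr) (Div place_expr (Cst 4)))
  (Seq (Put 2 (Add (Add (Cst 2) (Mul (Cst 12) count_expr)) place_expr) index_expr) c).

Definition outer_body : prog :=
  Seq (Put 6 (Cst 0) (Add (Mul (Cst 12) endv_expr) (Get 3 (Add (Cst 8) (Get 4 endv_expr)))))
  (record_place (Seq (Put 4 endv_expr (Add (Get 4 endv_expr) (Cst 1))) advance)).

Definition inner_body : prog :=
  Seq (Put 6 (Cst 0)
        (Add (Mul (Cst 12) (Div inner_index_expr (Cst 8)))
             (Get 3 (Sub inner_index_expr (Mul (Cst 8) (Div inner_index_expr (Cst 8)))))))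
  (record_place advance).

(** Truncated subtraction serves as a comparison: nonzero exactly while the current index is below
    [4 n]. *)
Definition outer_test : expr := Sub (Mul (Cst 4) count_expr) index_expr.
Definition inner_test : expr := Sub (Mul (Cst 12) count_expr) index_expr.

(** The table [inner_place] followed by [outer_place]. *)
Definition places : seq nat := [:: 3; 7; 2; 6; 1; 8; 5; 10; 0; 4; 9; 11].

(** [6 n] is the number [ne G + 4 n] of edges of the gadget map, as [ne G = 2 n]. *)
Definition prologue : prog :=
  Seq (Put 2 (Cst 0) (Mul (Cst 3) count_expr))
  (Seq (Put 2 (Cst 1) (Mul (Cst 6) count_expr))
   (put_seq 3 0 places)).

Definition halve_test : expr := Sub count_expr (Get 7 (Cst 0)).
Definition halve_body : prog :=
  Seq (Put 1 (Cst 0) (Div (Get 1 (Cst 0)) (Cst 2)))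
      (Put 7 (Cst 0) (Add (Get 7 (Cst 0)) (Cst 1))).

Definition query_size : expr := Add (Cst 2) (Mul (Cst 24) count_expr).

Definition reduction : prog :=
  Seq prologue
  (Seq (While outer_test outer_body)
  (Seq (While inner_test inner_body)
  (Seq (Ask 2 query_size 1)
       (While halve_test halve_body)))).

Definition reduction_time (n : nat) : nat :=
  ptime prologue +
  (n * 4 * (etime outer_test + ptime outer_body) + etime outer_test +
  (n * 8 * (etime inner_test + ptime inner_body) + etime inner_test +
  (etime query_size + (2 + n * 24) + 1 +
  (n * (etime halve_test + ptime halve_body) + etime halve_test)))).

(** The time is affine in [n], and [A + B n] is at most [(A + B) (n + 1)]. *)
Lemma reduction_time_le n : reduction_time n <= reduction_time 1 * n.+1.
Proof.
rewrite /reduction_time.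
move: (etime query_size) (etime outer_test) (etime inner_test) (etime halve_test).
move: (ptime prologue) (ptime outer_body) (ptime inner_body) (ptime halve_body).
clear; nia.
Qed.

(** * Correctness and running time of the reduction program *)

Section Reduction.
Variables (f : seq nat -> nat) (G : multigraph).
Hypothesis reg : four_regular G.
Notation n := (nv G).
Notation m := (ne G).
Notation b := (n * 12 + 13).
Notation w := (code_graph G).

(** Invariant of both filling loops once the first [k] ends are entered; the counters in array 4 are
    tracked separately, during the first loop. *)
Definition built (k : nat) (s : store) : Prop :=
  [/\ forall i, s 0 i = nth 0 w i,
      forall r, r < 12 -> s 3 r = nth 0 places r,
      s 5 0 = k /\ s 7 0 = 0,
      s 2 0 = 3 * n /\ s 2 1 = m + 4 * n
    & forall j, j < k -> s 2 (2 + j) = place G j %/ 4 /\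
                         s 2 (2 + n * 12 + place G j) = j].

Let b_gt0 : 0 < b. Proof. by rewrite addnS. Qed.

#[local] Hint Resolve b_gt0 : core.

(** Before the oracle call all cells hold at most [12 n + 12]. Bounding length by value is crude but
    costs only a linear factor. *)
Let small k : k <= n * 12 + 12 -> bits k <= b.
Proof. by move=> h; apply: leq_trans (bits_leS k) _; rewrite addnS ltnS. Qed.

(** The two new cells lie in disjoint ranges, one being fresh because [k] is new and the other by
    [place_inj], so earlier entries survive. *)
Lemma built_step k s s' :
  k < n * 12 -> built k s ->
  (forall a i, a \in [:: 0; 3; 7] -> s' a i = s a i) ->
  s' 5 0 = k.+1 ->
  (forall j, s' 2 j = if j == 2 + n * 12 + place G k then k
                      else if j == 2 + k then place G k %/ 4 else s 2 j) ->
  built k.+1 s'.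
Proof.
move=> hk [s0 s3 [s5 s7] [s20 s21] sp] h h5 h2; split.
- by move=> i; rewrite h.
- by move=> r hr; rewrite h // s3.
- by rewrite h5 h.
- by rewrite !h2.
move=> j; rewrite ltnS leq_eqVlt => /predU1P[->|hj].
  by rewrite !h2 !eqxx ifN //; apply/eqP; lia.
have jn := ltn_trans hj hk; have [e1 e2] := sp j hj; rewrite !h2 e1 e2; split.
  by rewrite !ifN //; apply/eqP; lia.
rewrite !ifN //; apply/eqP; first by lia.
by move=> /addnI /(place_inj reg jn hk); lia.
Qed.

Lemma runs_record k s (c : prog) (Q : store -> Prop) :
  k < n * 12 -> bounded b s -> built k s -> s 6 0 = place G k ->
  (forall s', bounded b s' ->
     (forall a i, a != 2 -> s' a i = s a i) ->
     (forall j, s' 2 j = if j == 2 + n * 12 + place G k then k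
                         else if j == 2 + k then place G k %/ 4 else s 2 j) ->
     runs f b c s' (ptime c) Q) ->
  runs f b (record_place c) s (ptime (record_place c)) Q.
Proof.
move=> hk bs [s0 _ [s5 _] _ _] s6 h; have hp := place_lt reg hk.
apply: runs_put_seq => //= [|b1]; first by apply: small; rewrite s6; lia.
apply: runs_put_seq => //= b2.
apply: h => // [a i a2|j]; first by rewrite /upd /= (negPf a2).
by rewrite /upd /= s0 s5 s6 (mulnC 12).
Qed.

Lemma runs_outer_body k s :
  k < n * 4 -> bounded b s ->
  built k s -> (forall v, s 4 v = ends_before G v k) ->
  runs f b outer_body s (ptime outer_body)
    (fun s' => built k.+1 s' /\ forall v, s' 4 v = ends_before G v k.+1).
Proof.
move=> hk bs B s4; have [s0 s3 [s5 _] _ _] := B.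
have hk2 : k < m * 2 by rewrite ne4.
have [x ex] := code_end_surj hk2.
have sv : s 0 (2 + s 5 0) = endv x by rewrite s0 s5 -ex nth_code_graph_end.
have lt4 : s 4 (s 0 (2 + s 5 0)) < 4 by rewrite sv s4 -ex ends_before_lt4.
have k12 : k < n * 12 by lia.
have hp := place_lt reg k12.
(* The offset 8 skips [inner_place], the first part of [places]. *)
have eP : 12 * s 0 (2 + s 5 0) + s 3 (8 + s 4 (s 0 (2 + s 5 0))) = place G k.
  rewrite s3; last by rewrite (ltn_add2l 8 _ 4).
  by rewrite sv /place hk2 -ex nth_code_graph_end s4 -ex; congr (_ + _).
apply: runs_put_seq => //= [|b1]; first by rewrite eP; apply: small; lia.
apply: (@runs_record k) => //.
move=> s1 b2 h1 h2.
have s10 i : s1 0 i = s 0 i by rewrite h1.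
have s15 : s1 5 0 = s 5 0 by rewrite h1.
have s14 i : s1 4 i = s 4 i by rewrite h1.
apply: runs_put_seq => //= [|b3].
  by rewrite s15 s10 s14; apply: small; lia.
apply: runs_put => //=.
  by rewrite /upd /= s15 s5; apply: small; lia.
split.
  apply: (@built_step k s) => //.
  - by move=> a i; rewrite !inE /upd => /or3P[]/eqP-> /=; rewrite h1.
  by rewrite /upd /= s15 s5 addn1.
move=> v; rewrite /upd /= s15 s10 !s14 sv -ex ends_beforeS eq_sym.
by case: eqP => [<-|_]; rewrite s4 ex // addn0.
Qed.

Lemma runs_inner_body k s :
  n * 4 <= k < n * 12 -> bounded b s -> built k s ->
  runs f b inner_body s (ptime inner_body) (built k.+1).
Proof.
move=> /andP[hk k12] bs B; have [s0 s3 [s5 _] _ _] := B.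
have hp := place_lt reg k12.
have hn : 4 * s 0 0 = m * 2 by rewrite s0 (ne4 reg) mulnC.
set z := k - m * 2.
have ez : s 5 0 - 4 * s 0 0 = z by rewrite hn s5.
(* The language has no remainder operation; this subtraction computes it. *)
have em : z - 8 * (z %/ 8) = z %% 8 by rewrite {1}(divn_eq z 8) mulnC addKn.
have eP : 12 * (z %/ 8) + s 3 (z - 8 * (z %/ 8)) = place G k.
  have hz : z %% 8 < 8 by rewrite ltn_mod.
  rewrite em s3; last exact: leq_trans hz _.
  have nk : (k < m * 2) = false by rewrite ltnNge (ne4 reg) hk.
  rewrite /place nk -/z; congr (_ + _).
  by move: hz; case: (z %% 8) => [|[|[|[|[|[|[|[|]]]]]]]].
apply: runs_put_seq => //= [|b1]; first by rewrite ez eP; apply: small; lia.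
apply: (@runs_record k) => //; first by rewrite /upd /= ez eP.
move=> s1 b2 h1 h2.
have s15 : s1 5 0 = s 5 0 by rewrite h1.
apply: runs_put => //=; first by rewrite s15 s5; apply: small; lia.
apply: (@built_step k s) => //.
- by move=> a i; rewrite !inE /upd => /or3P[]/eqP-> /=; rewrite h1.
by rewrite /upd /= s15 s5 addn1.
Qed.

Lemma ends_before0 v : ends_before G v 0 = 0.
Proof. by apply: eq_card0 => x; rewrite !inE andbF. Qed.

Lemma code_graph_le k : k \in w -> k <= n * 12 + 12.
Proof.
have := ne4 reg; rewrite !inE => mn /or3P[/eqP->|/eqP->|]; [lia | lia |].
case/flattenP => u /mapP[e _ ->]; rewrite !inE.
by case/orP => /eqP ->; apply: leq_trans (ltnW (ltn_ord _)) _; lia.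
Qed.

Lemma bounded_init : bounded b (init_store w).
Proof.
move=> a i; rewrite /init_store; apply: small; case: ifP => _.
  case: (ltnP i (size w)) => h; last by rewrite nth_default.
  exact/code_graph_le/mem_nth.
by case: ifP => // _; rewrite size_code_graph (ne4 reg); lia.
Qed.

Lemma runs_prologue :
  runs f b prologue (init_store w) (ptime prologue)
    (fun s => built 0 s /\ forall v, s 4 v = ends_before G v 0).
Proof.
have s0 : init_store w 0 0 = n by [].
have b0 := bounded_init.
apply: runs_put_seq => // [|b1]; first by apply: small; rewrite /= s0; lia.
apply: runs_put_seq => // [|b2]; first by apply: small; rewrite /upd /= s0; lia.
apply: runs_weaken (leqnn _) _ (runs_put_seq_table f 3 0 b_gt0 b2 _) => [s hs|k]; last first.
  rewrite !inE => hk; apply: small; move: hk.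
  by do 11?[case/predU1P => [->|]]; [lia..|move/eqP->; lia].
split; last by move=> v; rewrite hs ends_before0.
split=> //.
  by move=> r hr; rewrite hs /= add0n hr subn0.
by rewrite !hs /upd /=; split=> //; have := ne4 reg; lia.
Qed.

Lemma runs_halve s k :
  bounded b s -> s 0 0 = n -> s 7 0 = 0 -> s 1 0 = 2 ^ n * k ->
  runs f b (While halve_test halve_body) s
    (n * (etime halve_test + ptime halve_body) + etime halve_test)
    (fun s' => s' 1 0 = k).
Proof.
move=> bs s0 s7 s1.
(* A factor 2 remains as long as [i < n], so every halving is exact. *)
pose I i (s : store) := [/\ s 0 0 = n, s 7 0 = i, i <= n & s 1 0 = 2 ^ (n - i) * k].
apply: (@runs_weaken _ _ _ _ _ _ (I n)) (leqnn _) _ _ => [s' [_ _ _]|].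
  by rewrite subnn mul1n.
apply: runs_while => //.
- by split=> //; rewrite subn0.
- by move=> i s' [e0 e7 hi _]; rewrite /= e0 e7 subn_eq0 eqn_leq hi.
move=> i s' hi bs' [e0 e7 _ e1]; apply: runs_put_seq => //= [|b1].
  by apply: leq_trans (bs' 1 0); apply/leq_bits2/leq_div.
apply: runs_put => //=; first by rewrite /upd /= e7; apply: small; lia.
rewrite /I /upd /= e7 addn1; split=> //.
by rewrite e1 -subnSK // expnS -mulnA mulKn.
Qed.

Lemma runs_reduction :
  oracle_for A_trails_4regular f ->
  runs f b reduction (init_store w) (reduction_time n)
    (fun s => s 1 0 = num_eulerian_tours G).
Proof.
move=> orf; have [M [regM nM codeM]] := gadget_map reg.
apply: runs_seq runs_prologue _ => s1 b1 [B1 c1].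
pose I1 i s := [/\ i <= n * 4, built i s & forall v, s 4 v = ends_before G v i].
have test1 i s : I1 i s -> (eval s outer_test == 0) = (i == n * 4).
  by case=> hi [s0 _ [s5 _] _ _] _; rewrite /= s0 s5 /= mulnC subn_eq0 eqn_leq hi.
apply: (runs_seq (Q1 := I1 (n * 4))).
  apply: runs_while => // i s hi bs [_ B c].
  by apply: runs_weaken (leqnn _) _ (runs_outer_body hi bs B c) => s' [].
move=> s2 b2 [_ B2 _].
pose I2 i s := i <= n * 8 /\ built (n * 4 + i) s.
apply: (runs_seq (Q1 := I2 (n * 8))).
  apply: runs_while => //.
  - by rewrite /I2 addn0.
  - move=> i s [hi [s0 _ [s5 _] _ _]]; rewrite /= s0 s5 /=; lia.
  move=> i s hi bs [_ B]; have hk : n * 4 <= n * 4 + i < n * 12 by lia.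
  apply: runs_weaken (leqnn _) _ (runs_inner_body hk bs B) => s'.
  by rewrite /I2 addnS.
move=> s3 b3 [_ []]; rewrite -mulnDr => s0 _ [s5 s7] [s20 s21] sp.
have n0 : s3 0 0 = n by rewrite s0.
have esz : eval s3 query_size = 2 + n * 24 by rewrite /= n0 mulnC.
have eq : query s3 2 (eval s3 query_size) = code_map M.
  by rewrite esz; apply: codeM => // k hk; exact: sp.
have ans : f (query s3 2 (eval s3 query_size)) = 2 ^ n * num_eulerian_tours G.
  by rewrite eq -nM; exact: (orf (exist _ M regM)).
rewrite -esz; apply: (runs_seq (Q1 := fun s => s = upd s3 1 0 (2 ^ n * num_eulerian_tours G))).
  apply: runs_ask => //; last by rewrite ans.
  rewrite ans; apply: leq_bits => //.
  (* Replacing 3 by 4 bounds the answer by the power of two [2 ^ (3 n)], below [2 ^ b]. *)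
  have h34 : 3 ^ n <= 4 ^ n by case: (n) => // k; rewrite leq_exp2r.
  apply: (@leq_ltn_trans (2 ^ n * 4 ^ n)).
    by rewrite leq_mul2l (leq_trans (num_eulerian_tours_le reg) h34) orbT.
  by rewrite -(expnM 2 2) -expnD ltn_exp2l //; lia.
move=> s bs es; apply: runs_halve => //; by rewrite es.
Qed.

End Reduction.

Theorem theorem3 : poly_time_Turing_reducible ET_4regular A_trails_4regular.
Proof.
(* The time is at most [reduction_time n * (12 n + 13)], and the factors are at most
   [reduction_time 1 * (n + 1)] and [13 * (n + 1)]. *)
exists reduction, ((reduction_time 1 * 13)%:P * ('X + 1) ^+ 2)%R => f orf [G reg].
have [s [t [e ht _ es]]] := runs_reduction reg orf.
exists s, t; split=> //; apply: leq_trans ht _ => /=.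
(* Every cell of the input, even a zero, counts at least one bit, and there are [2 + 4 n] cells. *)
have n_le : nv G <= word_size (code_graph G).
  have: size (code_graph G) <= word_size (code_graph G).
    by rewrite -sum1_size; apply: leq_sum.
  by rewrite size_code_graph (ne4 reg); lia.
move: n_le; set L := word_size _ => n_le.
rewrite !hornerE -[X in _ <= X]/(reduction_time 1 * 13 * (L + 1) * (L + 1)).
have := reduction_time_le (nv G); move: (reduction_time _) (reduction_time 1) => k k1 hk.
nia.
Qed.
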